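(* Let $G=(V,E)$ be a finite graph with adjacency matrix $A$, and let $I,J\subset V$ be disjoint sets of cardinality $b$. Assume that there exists at least one path matching from $I$ to $J$ and that all minimal path matchings from $I$ to $J$ have the same matching map. Let $|V|-\ell$ be the length of a minimal path matching. If $m_1,\dots,m_r$ are the multiplicities of the distinct eigenvalues $\lambda_1,\dots,\lambda_r$ of $A$, then $$\sum_{i=1}^r(m_i-b)_+\le\ell.$$ Consequently, for any $1\le k\le r$, $m_1+\dots+m_k\le kb+\ell$.
   Context: For disjoint $I=\{i_1,\dots,i_b\}$, $J=\{j_1,\dots,j_b\}\subset V$, a path matching from $I$ to $J$ is a collection $\Pi=\{\pi_1,\dots,\pi_b\}$ of pairwise vertex-disjoint self-avoiding paths $\pi_s=(u_{s,1},\dots,u_{s,p_s})$ in $G$ such that, for some permutation $\sigma$ of $\{1,\dots,b\}$, $u_{s,1}=i_s$ and $u_{s,p_s}=j_{\sigma(s)}$ for all $s$; $\sigma$ is its matching map. Its length is $|\Pi|=\sum_s p_s$ (the total number of vertices on the paths). A minimal path matching is one of minimal length. $x_+=\max(x,0)$. *)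

(* Defs.v *)
From HB Require Import structures.
From mathcomp Require Import all_boot all_order all_fingroup all_algebra all_field.
Set Implicit Arguments. Unset Strict Implicit. Unset Printing Implicit Defensive.
Import Order.TTheory GRing.Theory Num.Theory.

Definition simple_graph n (e : rel 'I_n) : Prop :=
  symmetric e /\ irreflexive e.

Definition adjacency n (e : rel 'I_n) : 'M[algC]_n :=
  \matrix_(i, j) (((e i j)%:R)%R : algC).

(* A path matching from I to J (I, J : 'I_b -> 'I_n enumerations of the
   two vertex sets).  The s-th path is the vertex sequence  I s :: P s ;
   sigma is the matching map. *)
Definition is_path_matching n b (e : rel 'I_n) (I J : 'I_b -> 'I_n)
    (P : 'I_b -> seq 'I_n) (sigma : 'S_b) : Prop :=
  (forall s : 'I_b,
      [/\ path e (I s) (P s), uniq (I s :: P s) & last (I s) (P s) = J (sigma s)])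
  /\ (forall s t : 'I_b, s != t -> [disjoint (I s :: P s) & (I t :: P t)]).

(* Length = total number of vertices on the paths. *)
Definition pm_length n b (P : 'I_b -> seq 'I_n) : nat :=
  \sum_(s < b) (size (P s)).+1.

Definition is_min_path_matching n b (e : rel 'I_n) (I J : 'I_b -> 'I_n)
    (P : 'I_b -> seq 'I_n) (sigma : 'S_b) : Prop :=
  is_path_matching e I J P sigma /\
  forall P' sigma', is_path_matching e I J P' sigma' ->
    pm_length P <= pm_length P'.

(* Main.v *)
Require Import Defs.
From HB Require Import structures.
From mathcomp Require Import all_boot all_order all_fingroup all_algebra all_field.
Import Order.TTheory GRing.Theory Num.Theory.

(** In ['X - A] replace, for every [t], the column [I t] by the unit vector at
[J t]; up to sign the determinant [p] of the result is the minor of ['X - A]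
without the rows [J] and the columns [I].

On the one hand, the eigenvectors for [x] that vanish on [J] span a space of
dimension at least [m - b], where [m] is the multiplicity of [x] ([A] is real
symmetric), and the modified matrix maps each of them to a multiple of
['X - x]; hence [p] is divisible by [('X - x) ^+ (m - b)].

On the other hand, the permutations contributing to the Leibniz expansion of
[p] send [J t] to [I t] for every [t] and move every other vertex along an edge
or not at all; such a permutation contributes plus or minus ['X^f], with [f] its
number of fixed points.  Its orbits through [I] form a path matching of length
at most [n - f], so [p] has degree at most [l]; and when [f = l] this matching
is minimal, covers all the vertices that move, and its matching map determines
the number of orbits of the permutation, hence its sign.  The terms of degree
[l] thus all have the same sign, there is at least one of them, and [p] has
degree exactly [l]. *)

Set Implicit Arguments.
Unset Strict Implicit.
Unset Printing Implicit Defensive.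

Local Open Scope ring_scope.

(** * Ranks and eigenvalue multiplicities of normal matrices *)

Lemma mxrank_sum_le (F : fieldType) m n (T : Type) (r : seq T) (Q : pred T)
    (M : T -> 'M[F]_(m, n)) :
  (\rank (\sum_(i <- r | Q i) M i)%R <= \sum_(i <- r | Q i) \rank (M i))%N.
Proof.
elim/big_ind2: _ => // [|M1 k1 M2 k2 le1 le2]; first by rewrite mxrank0.
exact: leq_trans (mxrank_add _ _) (leq_add le1 le2).
Qed.

Lemma mxrank_diag_le (F : fieldType) n (d : 'rV[F]_n) :
  (\rank (diag_mx d) <= #|[pred i | d 0%R i != 0%R]|)%N.
Proof.
have -> : diag_mx d = \sum_(i | d 0 i != 0) d 0 i *: delta_mx i i.
  apply/matrixP=> i j; rewrite summxE mxE.
  have [<-|ne_ij] := eqVneq i j; last first.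
    rewrite big1 // => k _; rewrite !mxE.
    by case: eqVneq => [<-|_]; rewrite ?(eq_sym j) ?(negPf ne_ij) mulr0.
  rewrite mulr1n; have [di0|di_nz] := eqVneq (d 0 i) 0.
    rewrite di0 big1 // => k _; rewrite !mxE.
    by case: (eqVneq i k) => [<-|_]; rewrite ?di0 ?mul0r ?mulr0.
  rewrite (bigD1 i) //= !mxE !eqxx mulr1 big1 ?addr0 // => k /andP[_ ne_ki].
  by rewrite !mxE eq_sym (negPf ne_ki) mulr0.
apply: leq_trans (mxrank_sum_le _ _ _) _.
rewrite -sum1_card leq_sum // => i _.
by rewrite (leq_trans (mxrank_scale _ _)) ?mxrank_delta.
Qed.

Lemma char_poly_conj (F : fieldType) n (P D : 'M[F]_n) :
  P \in unitmx -> char_poly (invmx P *m D *m P) = char_poly D.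
Proof.
move=> uP; rewrite /char_poly.
have -> : char_poly_mx (invmx P *m D *m P) =
    map_mx polyC (invmx P) *m char_poly_mx D *m map_mx polyC P.
  rewrite /char_poly_mx mulmxBr mulmxBl !map_mxM; congr (_ - _).
  by rewrite -mulmxA -scalar_mxC mulmxA -map_mxM mulVmx // map_mx1 mul1mx.
by rewrite !det_mulmx mulrAC -det_mulmx -map_mxM mulVmx // map_mx1 det1 mul1r.
Qed.

(** By unitary diagonalization, the left side counts the diagonal entries equal to [x], and
    [A - x%:M] has rank at most the number of the others. *)
Lemma mup_char_poly_normalmx (C : numClosedFieldType) n (A : 'M[C]_n) x :
  A \is normalmx -> (mup x (char_poly A) <= \rank (eigenspace A x))%N.
Proof.
move=> /orthomx_spectralP; set P := spectralmx A; set d := spectral_diag A => eqA.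
have uP : P \in unitmx by apply: spectral_unit.
rewrite mxrank_ker.
have -> : A - x%:M = invmx P *m diag_mx (d - const_mx x) *m P.
  rewrite raddfB /= diag_const_mx mulmxBr mulmxBl -eqA; congr (_ - _).
  by rewrite scalar_mxC -mulmxA mulVmx ?mulmx1.
rewrite mxrankMfree ?row_free_unit //.
apply: leq_trans (leq_sub2l _ (mxrankM_maxr _ _)).
apply: leq_trans (leq_sub2l _ (mxrank_diag_le _)).
have -> : char_poly A = \prod_(y <- [seq d 0 i | i <- enum 'I_n]) ('X - y%:P).
  rewrite {1}eqA char_poly_conj // char_poly_trig; last first.
    by apply: diag_mx_is_trig.
  rewrite big_map big_enum; apply: eq_bigr => i _.
  by rewrite mxE eqxx mulr1n.
rewrite mu_prod_XsubC count_map.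
rewrite -[X in (_ <= X - _)%N](card_ord n).
rewrite -(cardC [pred i | (d - const_mx x) 0 i != 0]) addKn.
rewrite -sum1_count big_enum_cond -sum1_card; apply/eq_leq/eq_bigl => i.
by rewrite !inE !mxE subr_eq0 negbK.
Qed.

(** * The modified matrix and the divisors of its determinant *)

Definition linkage_mx (F : fieldType) n b (A : 'M[F]_n) (I J : 'I_b -> 'I_n) :
    'M[{poly F}]_n :=
  \matrix_(i, j) if [pick t | I t == j] is Some t then (i == J t)%:R
                 else char_poly_mx A i j.

Lemma det_scale_rows (R : comNzRingType) n (M N : 'M[R]_n) (Q : pred 'I_n) a :
    (forall i j, M i j = (if Q i then a else 1) * N i j) ->
  \det M = a ^+ #|Q| * \det N.
Proof.
move=> eqM; have -> : M = diag_mx (\row_i if Q i then a else 1) *m N.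
  by apply/matrixP=> i j; rewrite mul_diag_mx !mxE eqM.
rewrite det_mulmx det_diag; congr (_ * _).
under eq_bigr do rewrite mxE.
by rewrite -big_mkcond prodr_const.
Qed.

Lemma linkage_mxI (F : fieldType) n b (A : 'M[F]_n) (I J : 'I_b -> 'I_n) i t :
  injective I -> linkage_mx A I J i (I t) = (i == J t)%:R.
Proof.
move=> injI; rewrite mxE; case: pickP => [t' /eqP/injI -> //|/(_ t)].
by rewrite eqxx.
Qed.

Lemma linkage_mxN (F : fieldType) n b (A : 'M[F]_n) (I J : 'I_b -> 'I_n) i j :
  (forall t, I t != j) -> linkage_mx A I J i j = char_poly_mx A i j.
Proof. by move=> Ij; rewrite mxE; case: pickP => // t; rewrite (negPf (Ij t)). Qed.

(** Multiply on the left by a constant invertible matrix whose first rows are a basis of the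
    eigenvectors vanishing on [J]; each of these rows of the product has a factor ['X - x%:P]. *)
Lemma dvdp_det_linkage_mx (F : fieldType) n b (A : 'M[F]_n)
    (I J : 'I_b -> 'I_n) x :
  injective I ->
  ('X - x%:P) ^+ (\rank (eigenspace A x) - b) %| \det (linkage_mx A I J).
Proof.
(* Multiplication by [K] restricts a row vector to its entries at [J]. *)
move=> injI; pose K : 'M[F]_(n, b) := colsub J 1%:M.
pose W := (eigenspace A x :&: kermx K)%MS.
pose U := row_ebase W.
have le_rank : (\rank (eigenspace A x) - b <= \rank W)%N.
  have := mxrank_sum_cap (eigenspace A x) (kermx K).
  rewrite -/W mxrank_ker => eq_rank.
  have leK : (\rank K <= b)%N by apply: rank_leq_col.
  have leK' : (\rank K <= n)%N by apply: rank_leq_row.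
  have leS := rank_leq_row (eigenspace A x + kermx K)%MS.
  rewrite leq_subLR -(leq_add2l (n - \rank K)) addnC -eq_rank.
  by rewrite addnA leq_add2r (leq_trans leS) // -{1}(subnK leK') leq_add2l.
have U_W (i : 'I_n) : (i < \rank W)%N -> (row i U <= W)%MS.
  move=> lt_i; rewrite -(eq_row_base W).
  have -> : row i U = row (Ordinal lt_i) (row_base W).
    rewrite /row_base row_mul -[LHS]mul1mx; apply/rowP=> j; rewrite !mxE.
    rewrite big_ord1 !mxE (bigD1 i) //= big1 ?addr0 => [|k ne_ki].
      by rewrite !mxE !eqxx lt_i.
    rewrite !mxE /= eq_sym -(inj_eq val_inj) /= in ne_ki *.
    by rewrite (negPf ne_ki) mul0r.
  exact: row_sub.
(* In column [I t] the product has the entry of the eigenvector at [J t], which is 0; the other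
   columns are those of ['X - A]. *)
have dvdU (i j : 'I_n) : (i < \rank W)%N ->
    (map_mx polyC U *m linkage_mx A I J) i j =
    ('X - x%:P) * (if [pick t | I t == j] is Some t then 0 else (U i j)%:P).
  move=> /U_W; rewrite sub_capmx => /andP[/eigenspaceP eigU /sub_kermxP kerU].
  rewrite mxE; case: pickP => [t /eqP <-|noI].
    rewrite mulr0 (bigD1 (J t)) //= linkage_mxI // eqxx mulr1 mxE.
    rewrite big1 ?addr0 => [|k /negPf ne_k]; last first.
      by rewrite linkage_mxI // ne_k mulr0.
    have /rowP/(_ t) := kerU; rewrite !mxE (bigD1 (J t)) //= !mxE eqxx mulr1.
    by rewrite big1 ?addr0 => [->//|k /negPf ne_k]; rewrite !mxE ne_k mulr0.
  transitivity (\sum_k ((U i k)%:P * ('X *+ (k == j)) - (row i U 0 k * A k j)%:P)).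
    apply: eq_bigr => k _; rewrite linkage_mxN => [|t]; last by rewrite noI.
    by rewrite !mxE mulrBr polyCM.
  rewrite sumrB -rmorph_sum /=.
  have -> : \sum_k row i U 0 k * A k j = (row i U *m A) 0 j by rewrite mxE.
  rewrite eigU !mxE polyCM mulrBl; congr (_ - _).
  rewrite (bigD1 j) //= eqxx mulrC big1 ?addr0 // => k /negPf ->.
  by rewrite mulr0.
(* [N] is the product with the factor removed from its first [\rank W] rows. *)
pose N : 'M[{poly F}]_n := \matrix_(i, j)
  if (i < \rank W)%N then (if [pick t | I t == j] is Some t then 0 else (U i j)%:P)
  else (map_mx polyC U *m linkage_mx A I J) i j.
have : \det (map_mx polyC U *m linkage_mx A I J) =
    ('X - x%:P) ^+ #|[pred i : 'I_n | (i < \rank W)%N]| * \det N.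
  apply: det_scale_rows => i j; rewrite inE [N i j]mxE.
  by case: ltnP => lt_i; rewrite ?mul1r // dvdU.
have -> : #|[pred i : 'I_n | (i < \rank W)%N]| = \rank W.
  by rewrite -sum1_card (big_ord_narrow (rank_leq_row W)) sum1_card card_ord.
rewrite det_mulmx det_map_mx => detE.
have detU : \det U != 0 by rewrite -unitfE -unitmxE row_ebase_unit.
by rewrite -(dvdpZr _ _ detU) -mul_polyC detE dvdp_mulr // dvdp_exp2l.
Qed.

(** Powers of distinct ['X - x%:P] are coprime, so their product divides [p]; the inequality is
    strict because size is degree plus one. *)
Lemma sum_dvdp_lt_size (F : fieldType) (p : {poly F}) (s : seq F) (k : F -> nat) :
    p != 0 -> uniq s -> {in s, forall x, ('X - x%:P) ^+ k x %| p} ->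
  (\sum_(x <- s) k x < size p)%N.
Proof.
move=> p_nz Us dvd_p.
suff dvd_prod : \prod_(x <- s) ('X - x%:P) ^+ k x %| p.
  apply: leq_trans (dvdp_leq p_nz dvd_prod).
  rewrite leq_eqVlt; apply/orP; left; apply/eqP.
  elim: s {Us dvd_p dvd_prod} => [|x s IHs]; first by rewrite !big_nil size_poly1.
  rewrite !big_cons size_monicM ?monic_exp ?monicXsubC //.
    by rewrite size_exp_XsubC -IHs addnS.
  by rewrite -size_poly_gt0 -IHs.
elim: s Us dvd_p => [|x s IHs] /=; first by rewrite big_nil dvd1p.
move=> /andP[s'x Us] dvd_p; rewrite big_cons Gauss_dvdp.
  by rewrite dvd_p ?mem_head // IHs // => y sy; rewrite dvd_p // inE sy orbT.
elim: s s'x {IHs Us dvd_p} => [|y s IHs]; first by rewrite big_nil coprimep1.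
rewrite inE negb_or => /andP[ne_xy s'x]; rewrite big_cons coprimepMr IHs // andbT.
by rewrite coprimep_expl ?coprimep_expr // coprimep_XsubC2 // subr_eq0 eq_sym.
Qed.

(** * The permutations in the Leibniz expansion *)

Definition fixed_set n (tau : 'S_n) : {set 'I_n} := [set i | tau i == i].

(** These are the permutations with a nonzero term. Vertices of [J] are exempt from the edge
    condition: the step from [J t] to [I t] closes a path. *)
Definition is_linking n b (e : rel 'I_n) (I J : 'I_b -> 'I_n) (tau : 'S_n) : bool :=
  [forall t, tau (J t) == I t] &&
  [forall i, [|| i \in codom J, tau i == i | e i (tau i)]].

Lemma prod_linkage_mx n b (e : rel 'I_n) (I J : 'I_b -> 'I_n) (tau : 'S_n) :
    irreflexive e -> injective I -> injective J -> (forall s t, I s != J t) ->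
  \prod_i linkage_mx (adjacency e) I J i (tau i) =
  if is_linking e I J tau
  then (-1) ^+ (#|~: fixed_set tau| + b) *: 'X^#|fixed_set tau| else 0.
Proof.
move=> irr_e injI injJ neIJ; case: ifPn => [/andP[/forallP HJ /forallP He]|].
  (* The entry 1 in row [J t] is written as (-1)(-1), so that every moved vertex contributes -1; the
     second factor accounts for [b] in the exponent. *)
  have entry i : linkage_mx (adjacency e) I J i (tau i) =
      (if tau i == i then 'X else -1) * (if i \in codom J then -1 else 1).
    case: codomP => [[t ->]|notJ].
      rewrite (eqP (HJ t)) linkage_mxI // eqxx (negPf (neIJ _ _)).
      by rewrite mulrNN mulr1.
    rewrite linkage_mxN ?mulr1 => [|t]; last first.
      apply/eqP=> It; apply: notJ; exists t; apply: (@perm_inj _ tau).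
      by rewrite (eqP (HJ t)).
    rewrite !mxE eq_sym; case: eqP => [->|neq]; first by rewrite irr_e subr0.
    have /or3P[/codomP //|/eqP //|->] := He i.
    by rewrite sub0r.
  under eq_bigr do rewrite entry.
  rewrite big_split /= -big_mkcond prodr_const card_codom // card_ord.
  rewrite (bigID (mem (fixed_set tau))) /=.
  have -> : \prod_(i in fixed_set tau) (if tau i == i then 'X else -1 : {poly algC}) =
            'X^#|fixed_set tau|.
    by rewrite -prodr_const; apply: eq_bigr => i; rewrite inE => ->.
  have -> : \prod_(i | i \notin fixed_set tau) (if tau i == i then 'X else -1 : {poly algC}) =
            (-1) ^+ #|~: fixed_set tau|.
    by rewrite -prodr_const; apply: eq_big => i; rewrite !inE // => /negPf ->.
  by rewrite -mulrA -exprD mulrC -mul_polyC rmorphXn rmorphN1.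
rewrite negb_and => /orP[/forallPn[t neJ]|/forallPn[i]].
  (* Column [I t] is met in a row other than [J t], where it vanishes. *)
  apply/eqP/prodf_eq0; exists (tau^-1 (I t))%g => //.
  rewrite permKV linkage_mxI //.
  have [eqJ|_] := eqVneq (tau^-1%g (I t)) (J t); last by rewrite eqxx.
  by rewrite -eqJ permKV eqxx in neJ.
rewrite !negb_or => /and3P[notJ nfix notE].
apply/eqP/prodf_eq0; exists i => //.
case: (pickP [pred t | I t == tau i]) => [t /= /eqP <-|notI].
  rewrite linkage_mxI //; have [eqJ|_] := eqVneq i (J t); last by rewrite eqxx.
  by rewrite eqJ codom_f in notJ.
rewrite linkage_mxN => [|t]; last by rewrite [_ == _]notI.
by rewrite !mxE (eq_sym i) (negPf nfix) (negPf notE) subr0.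
Qed.

(** * Linking permutations and path matchings *)

(** The maps have the same fibres; [h] sends a value of [g'] to the value of [f'] at a chosen
    preimage. *)
Lemma eq_card_imset (T A B : finType) (f : T -> A) (g : T -> B) :
  (forall x y, (f x == f y) = (g x == g y)) -> #|f @: T| = #|g @: T|.
Proof.
suff le_card (A' B' : finType) (f' : T -> A') (g' : T -> B') :
    (forall x y, (f' x == f' y) = (g' x == g' y)) -> (#|f' @: T| <= #|g' @: T|)%N.
  by move=> eq_fg; apply/eqP; rewrite eqn_leq !le_card.
move=> eq_fg; pose h y := omap f' [pick x | g' x == y].
rewrite -(card_imset (f' @: T) Some_inj).
suff -> : Some @: (f' @: T) = h @: (g' @: T) by apply: leq_imset_card.
rewrite -!imset_comp; apply: eq_imset => x; rewrite /= /h.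
by case: pickP => [y|/(_ x)]; rewrite /= ?eqxx // -eq_fg => /eqP ->.
Qed.

Lemma card_path_matching n b (e : rel 'I_n) (I J : 'I_b -> 'I_n) P sigma :
    is_path_matching e I J P sigma ->
  #|[set x | [exists s, x \in I s :: P s]]| = pm_length P.
Proof.
case=> pathP disjP.
have -> : [set x | [exists s, x \in I s :: P s]] =
          (\bigcup_s [set x in I s :: P s])%SET.
  apply/setP=> x; rewrite inE; apply/existsP/bigcupP => [[s xs]|[s _]].
    by exists s; rewrite ?inE.
  by rewrite !inE => xs; exists s; rewrite inE.
rewrite -sum1_card partition_disjoint_bigcup => [|s t /disjP/pred0P dis_st].
  apply: eq_bigr => s _; rewrite sum1_card.
  have [_ /card_uniqP cardP _] := pathP s; rewrite -[RHS]/(size (I s :: P s)) -cardP.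
  by apply: eq_card => x; rewrite !inE.
by apply/pred0P=> x; have := dis_st x; rewrite /= !inE.
Qed.

Section LinkingPaths.

Variables (n b : nat) (e : rel 'I_n) (I J : 'I_b -> 'I_n) (tau : 'S_n).
Hypotheses (injI : injective I) (neIJ : forall s t, I s != J t).
Hypothesis tauL : is_linking e I J tau.

Let tauJ t : tau (J t) = I t.
Proof. by case/andP: tauL => /forallP/(_ t)/eqP. Qed.

Let iter_inj i : injective (iter i tau).
Proof. by elim: i => //= i IHi x y /perm_inj/IHi. Qed.

(** The orbit of [I s] contains [J s], the predecessor of [I s], so it meets [J]; the path from
    [I s] stops at the first meeting. *)
Lemma linking_first_hit : exists k : 'I_b -> nat, forall s,
  iter (k s) tau (I s) \in codom J /\
  (forall i, (i < k s)%N -> iter i tau (I s) \notin codom J).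
Proof.
suff hit s : exists k, iter k tau (I s) \in codom J /\
    (forall i, (i < k)%N -> iter i tau (I s) \notin codom J).
  exact: (fin_all_exists hit).
have exk : exists k, iter k tau (I s) \in codom J.
  have : J s \in porbit tau (I s).
    by rewrite porbit_sym -[I s]tauJ; apply: (mem_porbit tau 1).
  by case/porbitP=> k Jk; exists k; rewrite -permX -Jk codom_f.
case: (ex_minnP exk) => k hit min_k; exists k; split=> // i lt_ik.
by apply: contraL lt_ik => /min_k; rewrite -leqNgt.
Qed.

Variable k : 'I_b -> nat.
Hypothesis kP : forall s, iter (k s) tau (I s) \in codom J /\
  (forall i, (i < k s)%N -> iter i tau (I s) \notin codom J).

(** Cancelling the smaller exponent leaves [I s] on the path from [I t]; unless this is its start,
    the preceding vertex is [J s], and the path would have stopped there. *)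
Lemma linking_path_inj s t i j : (i <= k s)%N -> (j <= k t)%N ->
  iter i tau (I s) = iter j tau (I t) -> s = t /\ i = j.
Proof.
wlog le_ij : s t i j / (i <= j)%N => [IH le_is le_jt eq_ij|le_is le_jt].
  case/orP: (leq_total i j) => [le_ij|le_ji]; first exact: IH.
  by have [] := IH t s j i le_ji le_jt le_is (esym eq_ij).
rewrite -(subnKC le_ij) iterD => /iter_inj.
case def_d: (j - i)%N => [|d] /=; first by move/injI->; rewrite addn0.
rewrite -tauJ => /perm_inj Js; have [_ /(_ d)] := kP t.
rewrite -Js codom_f => hit; have /hit // : (d < k t)%N.
by apply: leq_trans le_jt; rewrite -def_d leq_subr.
Qed.

(** If an iterate is fixed then so is [I s], whence [I s = J s] by injectivity of [tau]. *)
Lemma linking_path_notfixed s i : iter i tau (I s) \notin fixed_set tau.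
Proof.
rewrite inE -iterS iterSr (inj_eq (@iter_inj i)).
by rewrite -[X in _ == X]tauJ (inj_eq perm_inj) neIJ.
Qed.

Variable sigma : 'S_b.
Hypothesis sigmaP : forall s, iter (k s) tau (I s) = J (sigma s).

Lemma linking_is_path_matching :
  is_path_matching e I J (fun s => traject tau (tau (I s)) (k s)) sigma.
Proof.
split=> [s|s t ne_st].
  split; last by rewrite last_traject.
    apply/(pathP (I s)) => i; rewrite size_traject => lt_ik.
    rewrite -trajectS nth_traject ?ltnS 1?ltnW //.
    rewrite (set_nth_default (tau (I s))) ?size_traject // nth_traject //.
    rewrite -iterSr iterS; have [_ /(_ i lt_ik) notJ] := kP s.
    have := linking_path_notfixed s i; rewrite inE.
    case/andP: tauL => _ /forallP/(_ (iter i tau (I s))).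
    by rewrite (negPf notJ) /= => /orP[->|].
  rewrite -trajectS; apply/(uniqP (I s)) => i j.
  rewrite !inE size_traject !ltnS => le_i le_j.
  by rewrite !nth_traject // => /linking_path_inj[].
apply/pred0P=> x /=; rewrite -!trajectS; apply/negP.
case/andP=> /trajectP[i lt_i ->] /trajectP[j lt_j] /linking_path_inj[] // eq_st.
by rewrite eq_st eqxx in ne_st.
Qed.

Let V := [set x | [exists s, x \in I s :: traject tau (tau (I s)) (k s)]].

Lemma linking_paths_sub : V \subset ~: fixed_set tau.
Proof.
apply/subsetP=> x; rewrite inE => /existsP[s]; rewrite -trajectS.
by case/trajectP=> i _ ->; rewrite in_setC linking_path_notfixed.
Qed.

(** The map induced by [sigma] on [I] is the first return map of [tau]. *)
Lemma linking_porbit s t :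
  (porbit tau (I s) == porbit tau (I t)) = (porbit sigma s == porbit sigma t).
Proof.
have step u : iter (k u).+1 tau (I u) = I (sigma u) by rewrite iterS sigmaP tauJ.
apply/idP/idP; rewrite !eq_porbit_mem !(porbit_sym _ _ t) !(porbit_sym _ _ (I t)).
  (* Strong induction on the exponent: either [I t] lies on the path from [I s], forcing [t = s], or
     one return to [I] is stripped off. *)
  case/porbitP=> i; rewrite permX; elim/ltn_ind: i s => i IHi s eq_t.
  case: (leqP i (k s)) => [le_ik|lt_ki].
    by have [-> _] := @linking_path_inj t s 0 i isT le_ik eq_t; rewrite porbit_id.
  have := IHi (i - (k s).+1)%N _ (sigma s).
  rewrite -step -iterD subnK // => /(_ _ eq_t) IH.
  have /eqP <- : porbit sigma (sigma s) == porbit sigma s.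
    by rewrite eq_porbit_mem; apply: (mem_porbit sigma 1).
  by apply: IH; rewrite ltn_subrL (leq_trans _ lt_ki).
case/porbitP=> i; rewrite permX => ->; elim: i => [|i IHi] /=; first exact: porbit_id.
rewrite -eq_porbit_mem in IHi; rewrite -(eqP IHi) -step -permX.
exact: mem_porbit.
Qed.

(** When the paths cover all moved vertices, each orbit is a fixed point or the orbit of some [I s];
    the latter are counted by the orbits of [sigma]. *)
Lemma linking_card_porbits : V = ~: fixed_set tau ->
  #|porbits tau| = (#|fixed_set tau| + #|porbits sigma|)%N.
Proof.
move=> eqV.
have -> : porbits tau = (set1 @: fixed_set tau) :|: [set porbit tau (I s) | s : 'I_b].
  apply/setP=> O; rewrite inE; apply/imsetP/orP => [[x _ ->]|].
    have [fx|nfx] := boolP (x \in fixed_set tau).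
      left; apply/imsetP; exists x => //; apply/setP=> y; rewrite inE.
      apply/porbitP/eqP => [[i ->]|->]; last by exists 0%N; rewrite permX.
      by rewrite permX; elim: i => //= i ->; rewrite inE in fx; apply/eqP.
    right; rewrite -in_setC -eqV inE in nfx; case/existsP: nfx => s.
    rewrite -trajectS => /trajectP[i _ ->]; apply/imsetP; exists s => //.
    by apply/eqP; rewrite eq_porbit_mem -permX mem_porbit.
  case=> /imsetP[x fx ->]; last by exists (I x).
  exists x => //; apply/setP=> y; rewrite inE; apply/eqP/porbitP => [->|[i ->]].
    by exists 0%N; rewrite permX.
  by rewrite permX; elim: i => //= i ->; rewrite inE in fx; apply/eqP.
rewrite cardsU; set C := #|_ :&: _|.
have -> : C = 0%N.
  apply: eq_card0 => O; rewrite inE; apply/negP=> /andP[/imsetP[x fx ->]].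
  case/imsetP=> s _ eqO; have := linking_path_notfixed s 0.
  have : I s \in [set x] by rewrite eqO porbit_id.
  by rewrite inE => /eqP /= ->; rewrite fx.
rewrite subn0 card_imset; last exact: set1_inj.
by congr (_ + _)%N; apply: eq_card_imset => s t; apply: linking_porbit.
Qed.

End LinkingPaths.

Lemma linking_path_matching n b (e : rel 'I_n) (I J : 'I_b -> 'I_n) (tau : 'S_n) :
    injective I -> (forall s t, I s != J t) -> is_linking e I J tau ->
  exists P (sigma : 'S_b),
    [/\ is_path_matching e I J P sigma, (pm_length P + #|fixed_set tau| <= n)%N &
        (pm_length P + #|fixed_set tau| = n)%N ->
        #|porbits tau| = (#|fixed_set tau| + #|porbits sigma|)%N].
Proof.
move=> injI neIJ tauL; have [k kP] := linking_first_hit tauL.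
have [f fP] : exists f : 'I_b -> 'I_b, forall s, iter (k s) tau (I s) = J (f s).
  suff ex_f s : exists t, iter (k s) tau (I s) = J t by apply: (fin_all_exists ex_f).
  by have [/codomP] := kP s.
(* Paths with a common end share a vertex, hence coincide. *)
have inj_f : injective f.
  move=> s t eq_f.
  by have [] := linking_path_inj injI tauL kP (leqnn (k s)) (leqnn (k t)) _; rewrite ?fP ?eq_f.
pose sigma := perm inj_f.
have sigmaP s : iter (k s) tau (I s) = J (sigma s) by rewrite permE fP.
have matchP := linking_is_path_matching injI neIJ tauL kP sigmaP.
have subV := linking_paths_sub neIJ tauL k.
have cardV := card_path_matching matchP.
have cardF : (#|~: fixed_set tau| + #|fixed_set tau| = n)%N.
  by rewrite addnC cardsC card_ord.
eexists; exists sigma; split; first exact: matchP.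
  by rewrite -cardV -[X in (_ <= X)%N]cardF leq_add2r subset_leq_card.
rewrite -cardV -[RHS]cardF => /addIn eq_card.
apply: (linking_card_porbits injI neIJ tauL kP sigmaP).
by apply/eqP; rewrite eqEcard subV eq_card leqnn.
Qed.

(* The permutation rotates the vertices of each path cyclically and then sends
   each [I s] to [I (sigma s)]. *)
Lemma path_matching_linking n b (e : rel 'I_n) (I J : 'I_b -> 'I_n) P (sigma : 'S_b) :
    irreflexive e -> injective I -> (forall s t, I s != J t) ->
    is_path_matching e I J P sigma ->
  exists2 tau, is_linking e I J tau & (pm_length P + #|fixed_set tau| = n)%N.
Proof.
move=> irr_e injI neIJ matchP; have [pathsP disjP] := matchP.
pose c s := I s :: P s.
have same_path x s t : x \in c s -> x \in c t -> s = t.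
  move=> xs xt; apply/eqP; apply: contraT => /disjP/pred0P/(_ x).
  by rewrite /= xs xt.
(* With [next] this rotates each path cyclically, with [prev] it undoes the rotation; vertices off
   the paths stay put. *)
pose rot_by (h : seq 'I_n -> 'I_n -> 'I_n) x :=
  if [pick s | x \in c s] is Some s then h (c s) x else x.
have rotE h s x : x \in c s -> rot_by h x = h (c s) x.
  rewrite /rot_by => xs; case: pickP => [t xt|/(_ s)]; last by rewrite xs.
  by rewrite (same_path _ _ _ xs xt).
have rotN h x : (forall s, x \notin c s) -> rot_by h x = x.
  by rewrite /rot_by => xN; case: pickP => // s; rewrite (negPf (xN s)).
have Uc s : uniq (c s) by have [] := pathsP s.
have rotK : cancel (rot_by (@next _)) (rot_by (@prev _)).
  move=> x; case: (pickP [pred s | x \in c s]) => [s /= xs|xN].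
    by rewrite (rotE _ s) ?(rotE _ s x) ?mem_next ?prev_next.
  by rewrite !rotN // => s; rewrite [_ \in _]xN.
pose g x := if [pick s | I s == x] is Some s then I (sigma s) else x.
have gI s : g (I s) = I (sigma s).
  rewrite /g; case: pickP => [t /eqP/injI -> //|/(_ s)].
  by rewrite eqxx.
have gN x : (forall s, I s != x) -> g x = x.
  by rewrite /g => xN; case: pickP => // s; rewrite (negPf (xN s)).
have g_inj : injective g.
  move=> x y; case: (pickP [pred s | I s == x]) => [s /= /eqP <-|xN];
    case: (pickP [pred s | I s == y]) => [t /= /eqP <-|yN].
  - by rewrite !gI => /injI/perm_inj ->.
  - rewrite gI (gN y) => [eq_y|t]; last by rewrite [_ == _]yN.
    by have := yN (sigma s); rewrite /= eq_y eqxx.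
  - rewrite gI (gN x) => [eq_x|s]; last by rewrite [_ == _]xN.
    by have := xN (sigma t); rewrite /= eq_x eqxx.
  by rewrite !gN // => s; rewrite [_ == _](xN, yN).
pose f := rot_by (@next _).
have f_inj : injective f := can_inj rotK.
pose tau := perm (inj_comp g_inj f_inj).
have tauE x : tau x = g (f x) by rewrite permE.
(* The rotation either closes the path, from its end to its start, or follows an edge to a vertex
   outside [I], on which [g] is the identity. *)
have f_step s x : x \in c s ->
    (x = J (sigma s) /\ f x = I s) \/ (e x (f x) /\ forall t, I t != f x).
  move=> xs; pose e' := [rel x y |
    (x == last (I s) (P s)) && (y == I s) || e x y && (y != I s)].
  have [path_s /andP[IsP _] last_s] := pathsP s.
  have cyc : path.cycle e' (c s).
    rewrite /= rcons_path /= !eqxx /= andbT.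
    apply/(pathP (I s)) => i lt_i; apply/orP; right.
    move/(pathP (I s)): path_s => /(_ i lt_i) -> /=.
    by apply: contraNneq IsP => <-; apply: mem_nth.
  have := next_cycle cyc xs; rewrite -(rotE (@next _) _ _ xs) -/f /= last_s.
  case/orP=> /andP[]; first by move=> /eqP-> /eqP->; left.
  move=> exf neI; right; split=> // t; apply/eqP=> eqI.
  have fxs : f x \in c s by rewrite /f (rotE _ s) ?mem_next.
  have eq_st : s = t by apply: (same_path (f x)); rewrite // -eqI mem_head.
  by rewrite -eqI eq_st eqxx in neI.
have f_last s : f (J (sigma s)) = I s.
  have ys : prev (c s) (I s) \in c s by rewrite mem_prev mem_head.
  have fy : f (prev (c s) (I s)) = I s by rewrite /f (rotE _ s) // next_prev.
  have [[<- //]|[_ /(_ s)]] := f_step _ _ ys.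
  by rewrite fy eqxx.
have tauJ t : tau (J t) = I t.
  by rewrite -[t](permKV sigma) tauE f_last gI.
have tauV s x : x \in c s -> x \in codom J \/ e x (tau x).
  case/f_step=> [[-> _]|[exf nI]]; first by left; apply: codom_f.
  by right; rewrite tauE gN.
have tauN x : (forall s, x \notin c s) -> tau x = x.
  move=> xN; rewrite tauE /f rotN // gN // => s.
  by apply: contraNneq (xN s) => <-; apply: mem_head.
exists tau.
  apply/andP; split; apply/forallP=> x; first by rewrite tauJ.
  case: (pickP [pred s | x \in c s]) => [s /= /tauV[->|->]|xN] //.
    by rewrite !orbT.
  by rewrite tauN ?eqxx ?orbT // => s; rewrite [_ \in _]xN.
(* The fixed points are exactly the vertices off the paths. *)
rewrite -(card_path_matching matchP) -[RHS]card_ord -[RHS](cardsC [set x | [exists s, x \in c s]]).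
congr (_ + _)%N; apply: eq_card => x; rewrite !inE.
apply/eqP/existsPn => [fix_x s|/tauN //].
apply/negP=> /tauV[/codomP[t eqJ]|]; last by rewrite fix_x irr_e.
by have := neIJ t t; rewrite -tauJ -eqJ fix_x eqxx.
Qed.

(** * The degree of the determinant and the bounds *)

Lemma coef_det_linkage_mx n b (e : rel 'I_n) (I J : 'I_b -> 'I_n) j :
    irreflexive e -> injective I -> injective J -> (forall s t, I s != J t) ->
  (\det (linkage_mx (adjacency e) I J))`_j =
  \sum_(tau : 'S_n | is_linking e I J tau && (#|fixed_set tau| == j))
    (-1) ^+ tau * (-1) ^+ (n - j + b).
Proof.
move=> irr_e injI injJ neIJ; rewrite coef_sum [RHS]big_mkcond.
apply: eq_bigr => tau _; rewrite prod_linkage_mx //.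
case: (is_linking e I J tau); last by rewrite mulr0 coef0.
have cardF : (n - #|fixed_set tau|)%N = #|~: fixed_set tau|.
  apply/eqP; rewrite -(eqn_add2l #|fixed_set tau|) cardsC card_ord subnKC //.
  by rewrite -[X in (_ <= X)%N]card_ord max_card.
rewrite -signr_odd -polyC1 -polyCN -polyC_exp signr_odd mul_polyC !coefZ coefXn eq_sym /=.
by case: eqP => [<-|_]; rewrite ?cardF ?mulr1 ?mulr0.
Qed.

Local Close Scope ring_scope.

Theorem theorem3p1 (n b l : nat) (e : rel 'I_n) (I J : 'I_b -> 'I_n)
    (eigs : seq algC) :
  simple_graph e ->
  injective I -> injective J -> (forall s t, I s != J t) ->
  (exists P sigma, is_path_matching e I J P sigma) ->
  (forall P1 s1 P2 s2, is_min_path_matching e I J P1 s1 ->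
      is_min_path_matching e I J P2 s2 -> s1 = s2) ->
  (exists P sigma, is_min_path_matching e I J P sigma /\ pm_length P = n - l) ->
  l <= n ->
  uniq eigs -> (forall x : algC, (x \in eigs) = root (char_poly (adjacency e)) x) ->
  (\sum_(lam <- eigs) (mup lam (char_poly (adjacency e)) - b) <= l)%N /\
  (forall k, 1 <= k <= size eigs ->
     (\sum_(lam <- take k eigs) mup lam (char_poly (adjacency e)) <= k * b + l)%N).
Proof.
move=> [sym_e irr_e] injI injJ neIJ _ uniq_sigma [P0 [sigma0 [min0 len0]]] le_ln Ueigs _.
pose p := (\det (linkage_mx (adjacency e) I J))%R.
have link_le tau : is_linking e I J tau -> #|fixed_set tau| <= l.
  case/(linking_path_matching injI neIJ) => P [sigma [matchP le_n _]].
  have := min0.2 _ _ matchP; rewrite len0 leq_subLR => le_l.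
  by rewrite -(leq_add2l (pm_length P)) (leq_trans le_n) // addnC.
(* The parity of a permutation is that of [n] minus its number of orbits; here the induced matching
   is minimal, so its matching map is [sigma0]. *)
have link_odd tau : is_linking e I J tau -> #|fixed_set tau| = l ->
    odd_perm tau = odd n (+) odd (l + #|porbits sigma0|).
  case/(linking_path_matching injI neIJ) => P [sigma [matchP le_n eq_orb]] fix_l.
  have ge_n := min0.2 _ _ matchP.
  have lenP : pm_length P = n - l.
    apply/eqP; rewrite eqn_leq -{2}len0 ge_n andbT.
    by rewrite -(addnK l (pm_length P)) leq_sub2r // -{1}fix_l.
  have minP : is_min_path_matching e I J P sigma.
    by split=> // P' sigma' /min0.2; rewrite len0 -lenP.
  rewrite /odd_perm card_ord eq_orb ?fix_l ?lenP ?subnK //.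
  by rewrite (uniq_sigma _ _ _ _ minP min0).
have p_coef j : (p`_j = \sum_(tau : 'S_n | is_linking e I J tau && (#|fixed_set tau| == j))
    (-1) ^+ tau * (-1) ^+ (n - j + b))%R by apply: coef_det_linkage_mx.
(* A sum of equal signs in characteristic 0, nonempty because [P0] yields a linking permutation with
   [l] fixed points. *)
have p_l : (p`_l != 0)%R.
  rewrite p_coef (eq_bigr (fun=> (-1) ^+ (odd n (+) odd (l + #|porbits sigma0|)) *
                             (-1) ^+ (n - l + b)))%R; last first.
    by move=> tau /andP[tauL /eqP/(link_odd _ tauL) ->].
  rewrite sumr_const mulrn_eq0 mulf_eq0 !signr_eq0 !orbF -lt0n.
  have [tau tauL fix_tau] := path_matching_linking irr_e injI neIJ min0.1.
  apply/card_gt0P; exists tau; rewrite unfold_in tauL /=.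
  by rewrite -(eqn_add2l (pm_length P0)) fix_tau len0 subnK.
have p_nz : p != 0%R by apply: contraNneq p_l => ->; rewrite coef0.
have size_p : size p <= l.+1.
  apply/leq_sizeP => j lt_lj; rewrite p_coef big1 // => tau /andP[/link_le le_l /eqP eq_j].
  by rewrite -eq_j ltnNge le_l in lt_lj.
have normA : adjacency e \is normalmx.
  apply: symmetric_normalmx; last by apply/mxOverP=> i j; rewrite mxE realn.
  by apply/is_hermitianmxP/matrixP=> i j; rewrite expr0 scale1r !mxE sym_e.
(* Truncated subtraction on naturals gives the positive part. *)
have sum_le : \sum_(lam <- eigs) (mup lam (char_poly (adjacency e)) - b) <= l.
  rewrite -ltnS (leq_trans _ size_p) // sum_dvdp_lt_size // => x _.
  apply: dvdp_trans (dvdp_det_linkage_mx (adjacency e) J x injI).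
  by rewrite dvdp_exp2l // leq_sub2r // mup_char_poly_normalmx.
split=> // k /andP[_ le_k].
(* Each multiplicity is at most [b] plus its truncated excess; the excesses beyond the first [k] are
   dropped. *)
apply: leq_trans (leq_add (leqnn _) sum_le).
rewrite -{2}(cat_take_drop k eigs) big_cat /= addnA (leq_trans _ (leq_addr _ _)) //.
rewrite -{2}(size_takel le_k) -sum1_size big_distrl /= -big_split leq_sum //= => x _.
by rewrite mul1n -leq_subLR.
Qed.
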